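(* Let $H$ be a non-factorizable semi-norming $k$-hypergraph pair which is either of Type II, or of Type I with parameter an even integer. Then for every $f,g\in\ell_H$, $$\|f+g\|_H^{|H|}+\|f-g\|_H^{|H|}\le(\|f\|_H+\|g\|_H)^{|H|}+\big|\|f\|_H-\|g\|_H\big|^{|H|}.$$
   Context: A $k$-hypergraph pair $H=(\alpha,\beta)$ consists of finite nonempty sets $V_1,\dots,V_k$ and functions $\alpha,\beta:V\to\mathbb{R}$, where $V=V_1\times\cdots\times V_k$; its size is $|H|=\sum_{\omega\in V}(|\alpha(\omega)|+|\beta(\omega)|)$. All measures are positive. For a measure space $\mathcal M=(\Omega,\mathcal F,\mu)$, the space $\Omega^{V_1}\times\cdots\times\Omega^{V_k}$ (points $x=(x_{i,v})_{i\in[k],v\in V_i}$) carries the product measure, and each $\omega=(\omega_1,\dots,\omega_k)\in V$ defines the projection $\omega(x)=(x_{1,\omega_1},\dots,x_{k,\omega_k})\in\Omega^k$. For measurable $f:\Omega^k\to\mathbb C$, $f^H(x)=\prod_{\omega\in V} f(\omega(x))^{\alpha(\omega)}\,\overline{f(\omega(x))^{\beta(\omega)}}$, with the convention $0^0=1$ (non-integer complex powers taken with a fixed branch). When $\alpha,\beta\ge 0$, set $\|f\|_H=(\int f^H)^{1/|H|}$, and let $L_H(\mathcal M)$ be the set of measurable $f$ with $\|\,|f|\,\|_H<\infty$. $H$ (with $\alpha,\beta\ge0$) is called norming (resp. semi-norming) if $\|\cdot\|_H$ is a norm (resp. semi-norm) on $L_H(\mathcal M)$ for every measure space $\mathcal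 M$. $\ell_H:=L_H(\mathbb N)$ with counting measure on $\mathbb N$. $H$ is non-factorizable if it is not isomorphic to a disjoint union of two hypergraph pairs (the disjoint union places two pairs on disjoint copies of the coordinate sets, zero elsewhere). $H$ is of Type I with parameter $s$ if $s\ge1$ and $\alpha(\psi)=\beta(\psi)=s/2$ for every $\psi\in{\rm supp}(\alpha)\cup{\rm supp}(\beta)$; $H$ is of Type II if $\{\alpha(\psi),\beta(\psi)\}=\{0,1\}$ for every $\psi\in{\rm supp}(\alpha)\cup{\rm supp}(\beta)$. *)

(* Defs.v *)
From HB Require Import structures.
From mathcomp Require Import all_boot all_order all_algebra.
From mathcomp Require Import all_classical all_reals all_analysis.
From mathcomp.real_closed Require Import complex.

Set Implicit Arguments.
Unset Strict Implicit.
Unset Printing Implicit Defensive.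

Import Order.TTheory GRing.Theory Num.Theory.
Import numFieldNormedType.Exports.

Local Open Scope ring_scope.

Section HypergraphPairs.
Variable R : realType.

Record hpair (k : nat) := HPair {
  hV : 'I_k -> finType;
  hV_nonempty : forall i, (0 < #|hV i|)%N;
  halpha : {dffun forall i : 'I_k, hV i} -> R;
  hbeta : {dffun forall i : 'I_k, hV i} -> R }.

Arguments halpha {k} h _.
Arguments hbeta {k} h _.

Variable k : nat.

Definition hedge (H : hpair k) := {dffun forall i : 'I_k, hV H i}.

Definition hsize (H : hpair k) : R :=
  \sum_(w : hedge H) (`|halpha H w| + `|hbeta H w|).

Definition hiso (H H' : hpair k) : Prop :=
  exists phi : forall i : 'I_k, hV H i -> hV H' i,
    (forall i, bijective (phi i)) /\
    forall w : hedge H,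
      let w' : hedge H' := [ffun i : 'I_k => phi i (w i)] in
      halpha H' w' = halpha H w /\ hbeta H' w' = hbeta H w.

Definition du_V (H1 H2 : hpair k) (i : 'I_k) : finType :=
  (hV H1 i + hV H2 i)%type.

Lemma du_V_nonempty (H1 H2 : hpair k) i : (0 < #|du_V H1 H2 i|)%N.
Proof. by rewrite /du_V card_sum ltn_addr // hV_nonempty. Qed.

Definition du_inl (H1 H2 : hpair k) (w : hedge H1) :
  {dffun forall i : 'I_k, du_V H1 H2 i} := [ffun i : 'I_k => inl (w i)].
Definition du_inr (H1 H2 : hpair k) (w : hedge H2) :
  {dffun forall i : 'I_k, du_V H1 H2 i} := [ffun i : 'I_k => inr (w i)].

Definition du_fun (H1 H2 : hpair k) (a1 : hedge H1 -> R) (a2 : hedge H2 -> R)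
  (w : {dffun forall i : 'I_k, du_V H1 H2 i}) : R :=
  match [pick w1 | du_inl H2 w1 == w] with
  | Some w1 => a1 w1
  | None => match [pick w2 | du_inr H1 w2 == w] with
            | Some w2 => a2 w2
            | None => 0
            end
  end.

Definition disj_union (H1 H2 : hpair k) : hpair k :=
  @HPair k (du_V H1 H2) (@du_V_nonempty H1 H2)
    (du_fun (halpha H1) (halpha H2)) (du_fun (hbeta H1) (hbeta H2)).

Definition factorizable (H : hpair k) : Prop :=
  exists H1 H2 : hpair k, hiso H (disj_union H1 H2).

Definition non_factorizable (H : hpair k) : Prop := ~ factorizable H.

Definition hsupp (H : hpair k) (w : hedge H) : Prop :=
  halpha H w != 0 \/ hbeta H w != 0.

Definition typeI (H : hpair k) (s : R) : Prop :=
  1 <= s /\ forall w, hsupp w -> halpha H w = s / 2 /\ hbeta H w = s / 2.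

Definition typeII (H : hpair k) : Prop :=
  forall w, hsupp w ->
    (halpha H w = 0 /\ hbeta H w = 1) \/ (halpha H w = 1 /\ hbeta H w = 0).

(** complex powers z^a, convention 0^0 = 1; for a a natural number this is
    the usual z^+a, otherwise the principal branch (arg in (-pi, pi]). *)
Definition carg (z : R[i]) : R :=
  let c := acos (complex.Re z / ComplexField.Normc.normc z) in
  if 0 <= complex.Im z then c else - c.

Definition cpow (z : R[i]) (a : R) : R[i] :=
  if a \is a Num.nat then z ^+ (Num.truncn a)
  else Complex ((ComplexField.Normc.normc z `^ a) * cos (a * carg z))
               ((ComplexField.Normc.normc z `^ a) * sin (a * carg z)).

(** coordinates (i, v), v in V_i; points of Omega^{V_1} x ... x Omega^{V_k}
    are #|coords|-tuples *)
Definition hcoord (H : hpair k) := {i : 'I_k & hV H i}.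

Definition hproj (T : Type) (H : hpair k) (w : hedge H)
  (x : #|{: hcoord H}|.-tuple T) : k.-tuple T :=
  [tuple tnth x (enum_rank (Tagged (fun i => hV H i : Type) (w i))) | i < k].

Definition fH (T : Type) (H : hpair k) (f : k.-tuple T -> R[i])
  (x : #|{: hcoord H}|.-tuple T) : R[i] :=
  \prod_(w : hedge H)
     (cpow (f (hproj w x)) (halpha H w) * conjc (cpow (f (hproj w x)) (hbeta H w))).

Arguments fH {T} H f x.

(** integral over Omega^n w.r.t. the product measure, as the iterated
    integral (= product integral by Fubini/Tonelli for sigma-finite mu and
    the (absolutely) integrable functions considered here) *)
Fixpoint iint d (T : measurableType d) (mu : set T -> \bar R) (n : nat) :
  (n.-tuple T -> \bar R) -> \bar R :=
  match n return (n.-tuple T -> \bar R) -> \bar R with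
  | 0 => fun F => F [tuple]
  | n'.+1 => fun F =>
      (\int[mu]_t iint mu (fun xs : n'.-tuple T => F [tuple of t :: xs]))%E
  end.

Definition cint d (T : measurableType d) (mu : set T -> \bar R) (n : nat)
  (F : n.-tuple T -> R[i]) : R[i] :=
  Complex (fine (iint mu (fun x => (complex.Re (F x))%:E)))
          (fine (iint mu (fun x => (complex.Im (F x))%:E))).

Definition cmeasurable d (T : measurableType d) (f : k.-tuple T -> R[i]) :=
  measurable_fun [set: k.-tuple T] (fun x => complex.Re (f x)) /\
  measurable_fun [set: k.-tuple T] (fun x => complex.Im (f x)).

Definition inLH (H : hpair k) d (T : measurableType d) (mu : set T -> \bar R)
  (f : k.-tuple T -> R[i]) : Prop :=
  cmeasurable f /\
  (iint mu (fun x => (complex.Re (fH H (fun y => ((ComplexField.Normc.normc (f y)) +i* 0)%C) x))%:E)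
     < +oo)%E.

Definition hnorm (H : hpair k) d (T : measurableType d) (mu : set T -> \bar R)
  (f : k.-tuple T -> R[i]) : R :=
  complex.Re (cint mu (fH H f)) `^ (hsize H)^-1.

Definition seminorm_on (H : hpair k) d (T : measurableType d)
  (mu : set T -> \bar R) : Prop :=
  [/\ (forall f, inLH H mu f ->
         complex.Im (cint mu (fH H f)) = 0 /\ 0 <= complex.Re (cint mu (fH H f))),
      (forall f g, inLH H mu f -> inLH H mu g -> inLH H mu (fun x => f x + g x)),
      (forall (c : R[i]) f, inLH H mu f -> inLH H mu (fun x => c * f x)),
      (forall (c : R[i]) f, inLH H mu f ->
         hnorm H mu (fun x => c * f x) = ComplexField.Normc.normc c * hnorm H mu f) &
      (forall f g, inLH H mu f -> inLH H mu g ->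
         hnorm H mu (fun x => f x + g x) <= hnorm H mu f + hnorm H mu g)].

Definition semi_norming (H : hpair k) : Prop :=
  (forall w, 0 <= halpha H w) /\ (forall w, 0 <= hbeta H w) /\
  forall d (T : measurableType d) (mu : {sigma_finite_measure set T -> \bar R}),
    seminorm_on H mu.

Definition in_lH (H : hpair k) (f : k.-tuple nat -> R[i]) : Prop :=
  inLH H (@counting nat R) f.

Definition lHnorm (H : hpair k) (f : k.-tuple nat -> R[i]) : R :=
  hnorm H (@counting nat R) f.

End HypergraphPairs.

(* Main.v *)
(** Since [alpha] and [beta] take natural values, [f^H] is a product of [|H|]
    factors, each [f] or its conjugate evaluated along an edge, so that
    [||f + g||_H^|H|] expands into the sum, over the assignments of [f] or [g]
    to the factors, of mixed forms. By the Hoelder inequality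
    [|<f_j>_j| <= prod_j ||f_j||_H] the sum of the expansions for [f + g] and
    [f - g], where only the assignments using [g] an even number of times
    survive, is at most the same expansion of the scalars
    [||f||_H + ||g||_H] and [||f||_H - ||g||_H].

    The Hoelder inequality is obtained from the triangle inequality by a
    tensor power trick. If [||f||_H, ||g||_H <= 1] and all mixed forms are
    nonnegative, each of them is at most [||f + g||_H^|H| <= 2^|H|]; replacing
    [f, g] by their tensor squares squares the forms, so each form is at
    most 1. Tensoring first [f, g] with their conjugates replaces the forms
    by their squared moduli and makes them nonnegative. A bijection between
    [nat] and [nat * nat] turns tensor products into functions on [nat]. *)
Require Import Defs.
From HB Require Import structures.
From mathcomp Require Import all_boot all_order all_algebra.
From mathcomp Require Import all_classical all_reals all_analysis.
From mathcomp Require Import measurable_realfun.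
From mathcomp Require Import ring.
From mathcomp.real_closed Require Import complex.
Import Order.TTheory GRing.Theory Num.Theory.
Local Open Scope ring_scope.

Set Implicit Arguments.
Unset Strict Implicit.
Unset Printing Implicit Defensive.

Local Notation cnt R := (@counting nat R).

(** * Iterated sums over [nat] *)

Section IteratedSums.
Variable R : realType.
Local Open Scope ereal_scope.

Let measurable_nat (D : set nat) (f : nat -> \bar R) : measurable_fun D f.
Proof. by move=> *; exact: I. Qed.

Lemma iint_ge0 n (F : n.-tuple nat -> \bar R) :
  (forall x, 0 <= F x) -> 0 <= iint (cnt R) F.
Proof.
elim: n F => [|n IH] F F0 /=; first exact: F0.
by apply: integral_ge0 => t _; apply: IH.
Qed.

Lemma le_iint n (F G : n.-tuple nat -> \bar R) :
  (forall x, 0 <= F x) -> (forall x, F x <= G x) ->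
  iint (cnt R) F <= iint (cnt R) G.
Proof.
elim: n F G => [|n IH] F G F0 FG /=; first exact: FG.
by apply: ge0_le_integral => // t _; [exact: iint_ge0|exact: IH].
Qed.

(** One term of a nonnegative series is at most its sum. So every slice is summable, not just almost
    every one, and the inductions below can proceed slice by slice. *)
Lemma iint_cons_lty n (F : n.+1.-tuple nat -> \bar R) t :
  (forall x, 0 <= F x) -> iint (cnt R) F < +oo ->
  iint (cnt R) (fun x : n.-tuple nat => F [tuple of t :: x]) < +oo.
Proof.
move=> F0 /=; set g := fun t => iint _ _ => gy.
have g0 u : 0 <= g u by apply: iint_ge0.
apply: le_lt_trans gy; rewrite ge0_integral_count// -/(g t).
rewrite nneseries_esumT//.
by apply: esum_ge; exists [set t]%classic; rewrite ?fsets_set1 ?fsbig_set1//; split.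
Qed.

Lemma le_abse_iint n (F : n.-tuple nat -> R) :
  `|iint (cnt R) (fun x => (F x)%:E)| <= iint (cnt R) (fun x => `|F x|%:E).
Proof.
elim: n F => [|n IH] F //=.
apply: le_trans (le_abse_integral _ _ _) _ => //.
by apply: ge0_le_integral => // t _; exact: IH.
Qed.

(** Under this condition the extended-real iterated sum of a signed function is finite, hence
    additive. *)
Definition abs_summable n (F : n.-tuple nat -> R) :=
  iint (cnt R) (fun x => `|F x|%:E) < +oo.

Lemma abs_summable_cons n (F : n.+1.-tuple nat -> R) t :
  abs_summable F -> abs_summable (fun x : n.-tuple nat => F [tuple of t :: x]).
Proof. by move=> /(iint_cons_lty t); apply=> x; rewrite lee_fin. Qed.

Lemma iint_fin_num n (F : n.-tuple nat -> R) :
  abs_summable F -> iint (cnt R) (fun x => (F x)%:E) \is a fin_num.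
Proof. by move=> Foo; rewrite fin_num_abs (le_lt_trans (le_abse_iint F)). Qed.

Lemma integrable_iint n (F : n.+1.-tuple nat -> R) : abs_summable F ->
  (cnt R).-integrable setT
    (fun t => iint (cnt R) (fun x : n.-tuple nat => (F [tuple of t :: x])%:E)).
Proof.
move=> Foo; apply/integrableP; split; first exact: measurable_nat.
by apply: le_lt_trans Foo => /=; apply: ge0_le_integral => // t _; exact: le_abse_iint.
Qed.

Lemma iintD n (F G : n.-tuple nat -> R) : abs_summable F -> abs_summable G ->
  iint (cnt R) (fun x => (F x + G x)%:E) =
  iint (cnt R) (fun x => (F x)%:E) + iint (cnt R) (fun x => (G x)%:E).
Proof.
elim: n F G => [|n IH] F G Foo Goo //=.
rewrite -integralD//; [|exact: integrable_iint..].
by apply: eq_integral => t _; rewrite IH//; exact: abs_summable_cons.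
Qed.

Lemma iintZ n (F : n.-tuple nat -> R) c : abs_summable F ->
  iint (cnt R) (fun x => (c * F x)%:E) = c%:E * iint (cnt R) (fun x => (F x)%:E).
Proof.
elim: n F => [|n IH] F Foo //=.
rewrite -integralZl//; last exact: integrable_iint.
by apply: eq_integral => t _; rewrite IH//; exact: abs_summable_cons.
Qed.

Lemma abs_summable_le n (F G : n.-tuple nat -> R) :
  (forall x, (`|F x| <= G x)%R) -> iint (cnt R) (fun x => (G x)%:E) < +oo ->
  abs_summable F.
Proof.
by move=> FG; apply: le_lt_trans; apply: le_iint => x; rewrite lee_fin.
Qed.

Lemma abs_summableD n (F G : n.-tuple nat -> R) :
  abs_summable F -> abs_summable G -> abs_summable (fun x => F x + G x)%R.
Proof.
move=> Foo Goo; apply: (@abs_summable_le _ _ (fun x => `|F x| + `|G x|)%R).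
  by move=> x; exact: ler_normD.
rewrite iintD ?lte_add_pinfty//; rewrite /abs_summable.
  by under eq_fun do rewrite normr_id.
by under eq_fun do rewrite normr_id.
Qed.

Lemma abs_summableZ n (F : n.-tuple nat -> R) c :
  abs_summable F -> abs_summable (fun x => c * F x)%R.
Proof.
move=> Foo; apply: (@abs_summable_le _ _ (fun x => `|c| * `|F x|)%R).
  by move=> x; rewrite normrM.
have F' : abs_summable (fun x => `|F x|)%R.
  by rewrite /abs_summable; under eq_fun do rewrite normr_id.
by rewrite iintZ// lte_mul_pinfty ?lee_fin.
Qed.

(** * Products of sums along a bijection of [nat] with [nat * nat] *)

Variables (p : nat -> nat * nat) (p_bij : bijective p).
Let p1 t := (p t).1.
Let p2 t := (p t).2.

(** The product on the right is a double sum of nonnegative terms over [nat * nat], which [p]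
    reindexes as one sum over [nat]. *)
Lemma ge0_integral_pair (f g : nat -> \bar R) :
  (forall t, 0 <= f t) -> (forall t, 0 <= g t) ->
  \int[cnt R]_t (f (p1 t) * g (p2 t)) =
  (\int[cnt R]_t f t) * (\int[cnt R]_t g t).
Proof.
move=> f0 g0.
have fg0 a b : 0 <= f a * g b by rewrite mule_ge0.
rewrite muleC -ge0_integralZl//; last exact: integral_ge0.
transitivity (\int[cnt R]_s \int[cnt R]_t (f s * g t)); last first.
  by apply: eq_integral => s _; rewrite ge0_integralZl// muleC.
rewrite !ge0_integral_count//; last by move=> k; exact: integral_ge0.
rewrite !nneseries_esumT//; last by move=> k; exact: integral_ge0.
under [RHS]eq_esum do rewrite ge0_integral_count// nneseries_esumT//.
rewrite (@esum_esum _ _ _ setT (fun=> setT) (fun i j => f i * g j))//.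
rewrite (_ : setT `*`` _ = setT)%classic; last by apply/seteqP; split.
by rewrite (@reindex_esum _ _ _ setT _ p)//; rewrite setTT_bijective.
Qed.

Lemma ge0_iint_pair n (F G : n.-tuple nat -> \bar R) :
  (forall x, 0 <= F x) -> (forall x, 0 <= G x) ->
  iint (cnt R) (fun x => F (map_tuple p1 x) * G (map_tuple p2 x)) =
  iint (cnt R) F * iint (cnt R) G.
Proof.
elim: n F G => [|n IH] F G F0 G0 /=.
  by congr (F _ * G _); apply/val_inj.
rewrite -ge0_integral_pair; [|by move=> t; exact: iint_ge0..].
apply: eq_integral => t _; rewrite -IH//.
by congr (iint _ _); apply/funext => x; congr (F _ * G _); apply/val_inj.
Qed.

Lemma abs_summable_pair n (F G : n.-tuple nat -> R) :
  abs_summable F -> abs_summable G ->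
  abs_summable (fun x => F (map_tuple p1 x) * G (map_tuple p2 x))%R.
Proof.
move=> Foo Goo; rewrite /abs_summable.
under eq_fun do rewrite normrM EFinM.
rewrite (ge0_iint_pair (F := fun x => `|F x|%:E) (G := fun x => `|G x|%:E))//.
have := iint_fin_num (F := fun x => `|F x|%R).
have := iint_fin_num (F := fun x => `|G x|%R).
rewrite /abs_summable.
under eq_fun do rewrite normr_id; move=> /(_ Goo) Gf.
under eq_fun do rewrite normr_id; move=> /(_ Foo) Ff.
by rewrite ltey_eq fin_numM.
Qed.

(** [fine] sends infinite values to 0; the rules for [rsum] assume [abs_summable], where this
    default does not arise. *)
Definition rsum n (F : n.-tuple nat -> R) : R :=
  fine (iint (cnt R) (fun x => (F x)%:E)).

Lemma rsumD n (F G : n.-tuple nat -> R) : abs_summable F -> abs_summable G ->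
  rsum (fun x => F x + G x)%R = (rsum F + rsum G)%R.
Proof. by move=> Foo Goo; rewrite /rsum iintD// fineD//; exact: iint_fin_num. Qed.

Lemma rsumZ n (F : n.-tuple nat -> R) c : abs_summable F ->
  rsum (fun x => c * F x)%R = (c * rsum F)%R.
Proof. by move=> Foo; rewrite /rsum iintZ// fineM//; exact: iint_fin_num. Qed.

Lemma abs_summable_norm n (F : n.-tuple nat -> R) :
  abs_summable F -> abs_summable (fun x => `|F x|%R).
Proof. by rewrite /abs_summable; under [in X in _ -> X]eq_fun do rewrite normr_id. Qed.

Let tens n (F G : n.-tuple nat -> R) (x : n.-tuple nat) : R :=
  (F (map_tuple p1 x) * G (map_tuple p2 x))%R.

Let ge0_rsum_pair n (F G : n.-tuple nat -> R) :
  (forall x, 0 <= F x)%R -> (forall x, 0 <= G x)%R ->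
  abs_summable F -> abs_summable G -> rsum (tens F G) = (rsum F * rsum G)%R.
Proof.
move=> F0 G0 Foo Goo; rewrite /rsum -fineM; [|exact: iint_fin_num..].
rewrite -ge0_iint_pair//; by move=> x; rewrite lee_fin.
Qed.

(** Signed functions reduce to nonnegative ones by [E = (|E| + E) - |E|] and bilinearity, applied
    first to [F] with a nonnegative second factor ([semi]), then to [G]. *)
Lemma rsum_pair n (F G : n.-tuple nat -> R) :
  abs_summable F -> abs_summable G ->
  rsum (fun x => F (map_tuple p1 x) * G (map_tuple p2 x))%R = (rsum F * rsum G)%R.
Proof.
have absD (E : n.-tuple nat -> R) x : (0 <= `|E x| + E x)%R.
  by rewrite addrC -lerBlDr sub0r lerNnormlW.
have split (E : n.-tuple nat -> R) :
    E = fun x => ((`|E x| + E x) + -1 * `|E x|)%R.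
  by apply/funext => x; rewrite mulN1r addrAC subrr add0r.
have absS E : abs_summable E -> abs_summable (fun x : n.-tuple nat => `|E x| + E x)%R.
  by move=> ?; apply: abs_summableD => //; exact: abs_summable_norm.
have semi (E1 E2 : n.-tuple nat -> R) : (forall x, 0 <= E2 x)%R ->
    abs_summable E1 -> abs_summable E2 -> rsum (tens E1 E2) = (rsum E1 * rsum E2)%R.
  move=> E20 E1oo E2oo; have := absS _ E1oo; have := abs_summable_norm E1oo.
  move=> E1n E1p.
  rewrite [in RHS](split E1) rsumD//; last exact: abs_summableZ.
  rewrite rsumZ// mulrDl -mulrA -!ge0_rsum_pair//.
  rewrite -rsumZ; last exact: abs_summable_pair.
  rewrite -rsumD; [|exact: abs_summable_pair|apply: abs_summableZ; exact: abs_summable_pair].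
  by congr rsum; apply/funext => x; rewrite {1}(split E1) /tens mulrDl mulrA.
move=> Foo Goo; rewrite -/(tens F G).
have Gp := absS _ Goo; have Gn := abs_summable_norm Goo.
rewrite [in RHS](split G) rsumD//; last exact: abs_summableZ.
rewrite rsumZ// mulrDr mulrCA -!semi//.
rewrite -rsumZ; last exact: abs_summable_pair.
rewrite -rsumD; [|exact: abs_summable_pair|apply: abs_summableZ; exact: abs_summable_pair].
by congr rsum; apply/funext => x; rewrite {1}(split G) /tens mulrDr mulrCA.
Qed.

End IteratedSums.

(** * Complex-valued iterated sums *)

Section ComplexSums.
Variable R : realType.
Implicit Type n : nat.
Local Notation C := R[i].
Local Notation normc := ComplexField.Normc.normc.
Local Notation csum := (cint (cnt R)).

Definition csummable n (F : n.-tuple nat -> C) :=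
  abs_summable (fun x => complex.Re (F x)) /\ abs_summable (fun x => complex.Im (F x)).

Lemma csumE n (F : n.-tuple nat -> C) :
  csum F = Complex (rsum (fun x => complex.Re (F x))) (rsum (fun x => complex.Im (F x))).
Proof. by []. Qed.

Lemma normc_ge_ReIm (z : C) : `|complex.Re z| <= normc z /\ `|complex.Im z| <= normc z.
Proof.
case: z => a b /=; rewrite -!sqrtr_sqr !ler_sqrt ?addr_ge0 ?sqr_ge0//.
by rewrite lerDl lerDr !sqr_ge0.
Qed.

Lemma csummable_le n (F : n.-tuple nat -> C) (G : n.-tuple nat -> R) :
  (forall x, normc (F x) <= G x) -> (iint (cnt R) (fun x => (G x)%:E) < +oo)%E ->
  csummable F.
Proof.
by move=> FG Goo; split; apply: abs_summable_le Goo => x;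
  apply: le_trans (FG x); case: (normc_ge_ReIm (F x)).
Qed.

Lemma csummableD n (F G : n.-tuple nat -> C) :
  csummable F -> csummable G -> csummable (fun x => F x + G x).
Proof.
move=> [F1 F2] [G1 G2]; split.
  by under eq_fun do rewrite raddfD; exact: abs_summableD.
by under eq_fun do rewrite raddfD; exact: abs_summableD.
Qed.

Lemma csumD n (F G : n.-tuple nat -> C) : csummable F -> csummable G ->
  csum (fun x => F x + G x) = csum F + csum G.
Proof.
move=> [F1 F2] [G1 G2]; rewrite !csumE.
under eq_fun do rewrite raddfD; rewrite rsumD//.
by under [X in Complex _ (rsum X)]eq_fun do rewrite raddfD; rewrite rsumD.
Qed.

Lemma csummable0 n : csummable (fun _ : n.-tuple nat => 0 : C).
Proof.
have S0 : abs_summable (fun _ : n.-tuple nat => 0 : R).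
  rewrite /abs_summable normr0.
  by elim: n => [|n IH] /=; rewrite ?integral0_eq ?ltry// => t _;
    elim: n {IH} => //= n IH; rewrite integral0_eq.
by split.
Qed.

Lemma csum0 n : csum (fun _ : n.-tuple nat => 0) = 0.
Proof.
have := csumD (csummable0 n) (csummable0 n); under eq_fun do rewrite addr0.
by move/esym/eqP; rewrite -subr_eq0 addrK => /eqP.
Qed.

Lemma csummable_sum n (I : Type) (r : seq I) (F : I -> n.-tuple nat -> C) :
  (forall i, csummable (F i)) -> csummable (fun x => \sum_(i <- r) F i x).
Proof.
move=> Foo; elim: r => [|i r IH].
  by under eq_fun do rewrite big_nil; exact: csummable0.
by under eq_fun do rewrite big_cons; exact: csummableD.
Qed.

Lemma csum_sum n (I : Type) (r : seq I) (F : I -> n.-tuple nat -> C) :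
  (forall i, csummable (F i)) ->
  csum (fun x => \sum_(i <- r) F i x) = \sum_(i <- r) csum (F i).
Proof.
move=> Foo; elim: r => [|i r IH].
  by under eq_fun do rewrite big_nil; rewrite csum0 big_nil.
under eq_fun do rewrite big_cons; rewrite csumD ?big_cons ?IH//.
exact: csummable_sum.
Qed.

Lemma csumZ n (F : n.-tuple nat -> C) c : csummable F ->
  csum (fun x => c * F x) = c * csum F.
Proof.
move=> [F1 F2]; case: c => a b; rewrite !csumE.
rewrite [RHS]/GRing.mul/=; congr Complex.
  rewrite -mulNr -!rsumZ// -rsumD; [|exact: abs_summableZ..].
  by congr rsum; apply/funext => x; case: (F x) => u v /=; rewrite mulNr.
rewrite -!rsumZ// -rsumD; [|exact: abs_summableZ..].
by congr rsum; apply/funext => x; case: (F x).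
Qed.

Lemma csum_conj n (F : n.-tuple nat -> C) : csummable F ->
  csum (fun x => conjc (F x)) = conjc (csum F).
Proof.
move=> [F1 F2]; rewrite !csumE /= -mulN1r -rsumZ//.
rewrite (_ : (fun x => complex.Re (conjc (F x))) = fun x => complex.Re (F x)).
  rewrite (_ : (fun x => complex.Im (conjc (F x))) = fun x => -1 * complex.Im (F x))//.
  by apply/funext => x; case: (F x) => a b; rewrite mulN1r.
by apply/funext => x; case: (F x).
Qed.

Variables (p : nat -> nat * nat) (p_bij : bijective p).
Let p1 t := (p t).1.
Let p2 t := (p t).2.

Lemma csum_pair n (F G : n.-tuple nat -> C) : csummable F -> csummable G ->
  csum (fun x => F (map_tuple p1 x) * G (map_tuple p2 x)) = csum F * csum G.
Proof.
move=> [F1 F2] [G1 G2]; rewrite !csumE.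
have rr := abs_summable_pair p_bij F1 G1; have ii := abs_summable_pair p_bij F2 G2.
have ri := abs_summable_pair p_bij F1 G2; have ir := abs_summable_pair p_bij F2 G1.
rewrite [RHS]/GRing.mul/=; congr Complex; rewrite -!(rsum_pair p_bij)//.
  rewrite -mulN1r -rsumZ// -rsumD//; last exact: abs_summableZ.
  by congr rsum; apply/funext => x; case: (F _) => ? ?; case: (G _) => ? ? /=; rewrite mulN1r.
rewrite -rsumD//.
by congr rsum; apply/funext => x; case: (F _) => ? ?; case: (G _).
Qed.

End ComplexSums.

(** * The factors of [f^H] *)

(** There are countably many tuples, and each singleton is a finite intersection of cylinders. Hence
    the measurability clause of [inLH] holds for every function on tuples of naturals. *)
Lemma measurable_set_tuple_nat k (A : set (k.-tuple nat)) : measurable A.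
Proof.
apply: countable_measurable; last exact: countableP.
move=> t; rewrite (_ : [set t]%classic =
    \bigcap_(i in [set: 'I_k]) (fun x : k.-tuple nat => tnth x i) @^-1` [set tnth t i])%classic.
  apply: fin_bigcap_measurable => // i _.
  by rewrite -[X in measurable X]setTI; apply: measurable_tnth.
apply/seteqP; split => [x -> //|x xt].
by apply: eq_from_tnth => i; exact: xt.
Qed.

Lemma bijective_nat_pair : exists p : nat -> nat * nat, bijective p.
Proof.
have /card_esym/card_set_bijP[p] := card_nat2.
by rewrite setTT_bijective; exists p.
Qed.

Section Slots.
Variables (R : realType) (k : nat) (H : hpair R k) (na nb : hedge H -> nat).
Hypothesis naE : forall w, halpha w = (na w)%:R.
Hypothesis nbE : forall w, hbeta w = (nb w)%:R.
Local Notation C := R[i].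
Local Notation normc := ComplexField.Normc.normc.

(* One slot for each of the [alpha w + beta w] factors of [f^H] coming from
   the edge [w]; the slots on the right carry a complex conjugation. *)
Definition slot : finType := {w : hedge H & ('I_(na w) + 'I_(nb w))%type}.

Definition slot_conj (j : slot) (z : C) : C :=
  if tagged j is inl _ then z else conjc z.

Definition slot_prod (T : Type) (h : slot -> k.-tuple T -> C)
    (x : #|{: hcoord H}|.-tuple T) : C :=
  \prod_j slot_conj j (h j (hproj (tag j) x)).

Lemma slot_conjD j : {morph slot_conj j : u v / u + v}.
Proof. by rewrite /slot_conj; case: (tagged j) => // _ u v; rewrite rmorphD. Qed.

Lemma slot_conjM j : {morph slot_conj j : u v / u * v}.
Proof. by rewrite /slot_conj; case: (tagged j) => // _ u v; rewrite rmorphM. Qed.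

Lemma slot_conj_conjc j z : slot_conj j (conjc z) = conjc (slot_conj j z).
Proof. by rewrite /slot_conj; case: (tagged j). Qed.

Lemma slot_conj_real j (r : R) : slot_conj j r%:C%C = r%:C%C.
Proof. by rewrite /slot_conj; case: (tagged j) => // _; rewrite conjc_real. Qed.

Lemma normc_conjc (z : C) : normc (conjc z) = normc z.
Proof. by case: z => a b /=; rewrite sqrrN. Qed.

Lemma normc_slot_conj j z : normc (slot_conj j z) = normc z.
Proof. by rewrite /slot_conj; case: (tagged j) => // _; rewrite normc_conjc. Qed.

Lemma normc_ge0 (z : C) : 0 <= normc z.
Proof. by case: z => a b; exact: sqrtr_ge0. Qed.

Lemma normc_real (r : R) : normc r%:C%C = `|r|.
Proof. by rewrite /= expr0n addr0 sqrtr_sqr. Qed.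

Lemma normc_prod (I : finType) (F : I -> C) :
  normc (\prod_i F i) = \prod_i normc (F i).
Proof.
exact: (big_morph _ (@ComplexField.Normc.normcM R) (@ComplexField.Normc.normc1 R)).
Qed.

Lemma cpow_nat (z : C) n : cpow z n%:R = z ^+ n.
Proof. by rewrite /cpow natr_nat natrK. Qed.

(** With natural exponents [cpow] is an ordinary power, that is, one factor per slot; the double
    product over edges and their slots is then flattened. *)
Lemma fHE T (f : k.-tuple T -> C) x : fH f x = slot_prod (fun=> f) x.
Proof.
rewrite /slot_prod /fH.
have /= <- := @sig_big_dep _ _ *%R (hedge H) (fun w => 'I_(na w) + 'I_(nb w))%type
  xpredT (fun w => xpredT) (fun w i => slot_conj
    (@Tagged _ w (fun w => 'I_(na w) + 'I_(nb w))%type i) (f (hproj w x))).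
apply: eq_bigr => w _; rewrite big_sumType /slot_conj /=.
by rewrite naE nbE !cpow_nat !prodr_const !card_ord rmorphXn.
Qed.

Lemma hsizeE : hsize H = #|slot|%:R.
Proof.
rewrite /hsize card_tagged sumnE big_map big_enum /= natr_sum.
by apply: eq_bigr => w _; rewrite naE nbE !normr_nat card_sum !card_ord natrD.
Qed.

Lemma normc_slot_prod T (h : slot -> k.-tuple T -> C) x :
  normc (slot_prod h x) = \prod_j normc (h j (hproj (tag j) x)).
Proof. by rewrite normc_prod; under eq_bigr do rewrite normc_slot_conj. Qed.

Definition slot_choice (T : Type) (s : {ffun slot -> bool})
  (f g : k.-tuple T -> C) (j : slot) := if s j then g else f.

Lemma prod_choiceD (S : comPzRingType) (a b : slot -> S) :
  \prod_j (a j + b j) = \sum_(s : {ffun slot -> bool}) \prod_j (if s j then b j else a j).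
Proof.
rewrite -(bigA_distr_bigA (fun j (c : bool) => if c then b j else a j)).
by apply: eq_bigr => j _; rewrite big_bool addrC.
Qed.

Lemma slot_prodD T (f g : k.-tuple T -> C) x :
  slot_prod (fun=> fun y => f y + g y) x = \sum_s slot_prod (slot_choice s f g) x.
Proof.
rewrite /slot_prod; under eq_bigr do rewrite slot_conjD.
rewrite prod_choiceD; apply: eq_bigr => s _; apply: eq_bigr => j _.
by rewrite /slot_choice; case: (s j).
Qed.

Lemma slot_prodZ T (c : slot -> R) (h : slot -> k.-tuple T -> C) x :
  slot_prod (fun j y => (c j)%:C%C * h j y) x = (\prod_j c j)%:C%C * slot_prod h x.
Proof.
rewrite /slot_prod rmorph_prod -big_split; apply: eq_bigr => j _ /=.
by rewrite slot_conjM slot_conj_real.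
Qed.

Lemma slot_prod_conj T (h : slot -> k.-tuple T -> C) x :
  slot_prod (fun j y => conjc (h j y)) x = conjc (slot_prod h x).
Proof.
rewrite /slot_prod rmorph_prod; apply: eq_bigr => j _ /=.
by rewrite slot_conj_conjc.
Qed.

Lemma hproj_map T U (q : T -> U) w (x : #|{: hcoord H}|.-tuple T) :
  hproj w (map_tuple q x) = map_tuple q (hproj w x).
Proof. by apply: eq_from_tnth => i; rewrite [RHS]tnth_map !tnth_mktuple tnth_map. Qed.

Definition tensor (T : Type) (q1 q2 : T -> T) (f g : k.-tuple T -> C) (y : k.-tuple T) : C :=
  f (map_tuple q1 y) * g (map_tuple q2 y).

Lemma slot_prod_tensor T (q1 q2 : T -> T) (h h' : slot -> k.-tuple T -> C) x :
  slot_prod (fun j => tensor q1 q2 (h j) (h' j)) x =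
  slot_prod h (map_tuple q1 x) * slot_prod h' (map_tuple q2 x).
Proof.
rewrite /slot_prod -big_split; apply: eq_bigr => j _ /=.
by rewrite /tensor slot_conjM !hproj_map.
Qed.

Lemma inLHE (f : k.-tuple nat -> C) :
  inLH H (cnt R) f <->
  (iint (cnt R) (fun x : #|{: hcoord H}|.-tuple nat =>
     (\prod_(j : slot) normc (f (hproj (tag j) x)))%:E) < +oo)%E.
Proof.
have E x : complex.Re (fH (fun y => (normc (f y) +i* 0)%C) x) =
    \prod_(j : slot) normc (f (hproj (tag j) x)).
  rewrite fHE /slot_prod.
  under eq_bigr do rewrite (slot_conj_real _ (normc _)).
  by rewrite -rmorph_prod.
rewrite /inLH; under eq_fun do rewrite E; split=> [[]//|foo]; split=> //.
by split=> _ B _; exact: measurable_set_tuple_nat.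
Qed.

End Slots.

(** * Hoelder inequality *)

(** If [r > 1], Bernoulli's inequality makes these powers unbounded. The exponents are powers of two
    because the bound will come from iterated tensor squaring. *)
Lemma le1_of_expr_bounded (R : realType) (r B : R) :
  (forall m, r ^+ (2 ^ m) <= B) -> r <= 1.
Proof.
move=> rB; rewrite leNgt; apply/negP => r1.
have r0 : 0 < r by apply: lt_trans r1.
have bern m : 1 + m%:R * (r - 1) <= r ^+ m.
  elim: m => [|m IH]; first by rewrite mul0r addr0 expr0.
  have := ler_wpM2l (ltW r0) IH; rewrite -exprS; apply: le_trans.
  rewrite -subr_ge0 [X in 0 <= X](_ : _ = m%:R * (r - 1) ^+ 2).
    by rewrite mulr_ge0 ?sqr_ge0.
  by rewrite -natr1; ring.
have B0 : 0 <= B by apply: le_trans (rB 0%N); rewrite exprn_ge0// ltW.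
(* For this [m], already [m * (r - 1)] exceeds [B], and [m <= 2 ^ m]. *)
pose m := Num.bound (B / (r - 1)).
have : B < m%:R * (r - 1).
  rewrite -ltr_pdivrMr ?subr_gt0//.
  by rewrite archi_boundP// divr_ge0// subr_ge0 ltW.
apply/negP; rewrite -leNgt; apply: le_trans (rB m).
apply: le_trans (bern _); apply: (@le_trans _ _ (m%:R * (r - 1) + 1)); first by rewrite lerDl.
rewrite addrC lerD2l ler_wpM2r ?subr_ge0 ?(ltW r1)// ler_nat.
exact/ltnW/ltn_expl.
Qed.

(** This is the limit [e -> 0], made explicit by a bound of the product that is affine in [e] on
    [0 < e <= 1]. It serves to normalize by [norm u + e] when [norm u] may vanish. *)
Lemma le_prod_of_addgt0 (R : realFieldType) (I : finType) (c : I -> R) (X : R) :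
  (forall i, 0 <= c i) -> (forall e, 0 < e -> X <= \prod_i (c i + e)) ->
  X <= \prod_i c i.
Proof.
move=> c0 Xc.
have [K [K0 KP]] : exists K, 0 <= K /\ forall e, 0 < e <= 1 ->
    \prod_i (c i + e) <= \prod_i c i + K * e.
  elim: (index_enum I) => [|i r [K [K0 IH]]].
    by exists 0; split=> // e _; rewrite !big_nil mul0r addr0.
  have P0 : 0 <= \prod_(j <- r) c j by rewrite prodr_ge0.
  (* The coefficient of [e] in [(c i + e) * (P + K * e)], with [P] the product over [r], after
     bounding [e ^ 2] by [e]. *)
  exists (c i * K + \prod_(j <- r) c j + K); split.
    by rewrite !addr_ge0// mulr_ge0.
  move=> e /andP[e0 e1]; rewrite !big_cons.
  apply: (@le_trans _ _ ((c i + e) * (\prod_(j <- r) c j + K * e))).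
    by rewrite ler_wpM2l ?IH ?e0 ?e1// addr_ge0// ltW.
  rewrite -subr_ge0 [X in 0 <= X](_ : _ = K * e * (1 - e)); last by ring.
  by rewrite !mulr_ge0 ?subr_ge0 ?(ltW e0).
apply/ler_addgt0Pr => e e0.
(* Dividing by [K + 1] avoids a zero denominator. *)
pose d := Num.min 1 (e / (K + 1)).
have d0 : 0 < d by rewrite lt_min ltr01 divr_gt0// ltr_wpDl.
apply: le_trans (Xc _ d0) _; apply: le_trans (KP d _) _.
  by rewrite d0 ge_min lexx.
rewrite lerD2l; apply: (@le_trans _ _ ((K + 1) * d)).
  by rewrite ler_wpM2r ?(ltW d0)// lerDl.
by rewrite mulrC -ler_pdivlMr ?ltr_wpDl// ge_min lexx orbT.
Qed.

Section Hoelder.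
Variables (R : realType) (k : nat) (H : hpair R k) (na nb : hedge H -> nat).
Hypothesis naE : forall w, halpha w = (na w)%:R.
Hypothesis nbE : forall w, hbeta w = (nb w)%:R.
Hypothesis sn : seminorm_on H (cnt R).
Hypothesis slot_gt0 : (0 < #|slot na nb|)%N.
Local Notation C := R[i].
Local Notation normc := ComplexField.Normc.normc.
Local Notation LH := (inLH H (cnt R)).
Local Notation norm := (hnorm H (cnt R)).
Local Notation n := #|slot na nb|.
Local Notation choice := (@slot_choice R k H na nb nat).

(** The mixed form [<h_j>_j], with one function per slot. *)
Definition form (h : slot na nb -> k.-tuple nat -> C) : C := cint (cnt R) (slot_prod h).

Lemma cint_fH f : cint (cnt R) (@fH R k nat H f) = form (fun=> f).
Proof. by congr cint; apply/funext => x; exact: fHE. Qed.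

(** Being a semi-norm includes that the integral of [f^H] is real and nonnegative, so the [n]-th
    power undoes the root; this uses [n > 0]. *)
Lemma form_norm f : LH f -> form (fun=> f) = (norm f ^+ n)%:C%C.
Proof.
case: sn => sn1 _ _ _ _ /sn1[]; rewrite /hnorm cint_fH => i0 r0.
rewrite -powR_mulrn ?powR_ge0// -powRrM (hsizeE naE nbE) mulVf ?pnatr_eq0 -?lt0n//.
by rewrite powRr1//; case: (form _) i0 => a b /= ->.
Qed.

Lemma norm_ge0 f : 0 <= norm f. Proof. exact: powR_ge0. Qed.

(** Every mixed product is dominated by the one for [|f| + |g|], which lies in [LH] because [LH] is
    closed under sums. *)
Lemma csummable_choice s f g : LH f -> LH g -> csummable (slot_prod (choice s f g)).
Proof.
move=> fL gL.
have absL (e : k.-tuple nat -> C) : LH e -> LH (fun y => (normc (e y))%:C%C).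
  move=> /(inLHE naE nbE) eoo; apply/(inLHE naE nbE).
  congr (iint _ _ < _)%E: eoo; apply/funext => x; congr (_%:E).
  by apply: eq_bigr => j _; rewrite normc_real ger0_norm ?normc_ge0.
case: sn => _ /(_ _ _ (absL _ fL) (absL _ gL)) /(inLHE naE nbE) fg _ _ _.
apply: csummable_le fg => x; rewrite normc_slot_prod.
apply: ler_prod => j _; rewrite normc_ge0 -rmorphD normc_real /slot_choice.
rewrite ger0_norm ?addr_ge0 ?normc_ge0//.
by case: (s j); rewrite ?lerDl ?lerDr normc_ge0.
Qed.

Lemma form_expand f g : LH f -> LH g ->
  form (fun=> fun y => f y + g y) = \sum_s form (choice s f g).
Proof.
move=> fL gL; rewrite /form -csum_sum; last by move=> s; exact: csummable_choice.
by congr cint; apply/funext => x; exact: slot_prodD.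
Qed.

Lemma formZ (c : slot na nb -> R) h : csummable (slot_prod h) ->
  form (fun j y => (c j)%:C%C * h j y) = (\prod_j c j)%:C%C * form h.
Proof.
move=> hs; rewrite /form -csumZ//; congr cint; apply/funext => x.
exact: slot_prodZ.
Qed.

Lemma form_conj h : csummable (slot_prod h) ->
  form (fun j y => conjc (h j y)) = conjc (form h).
Proof.
move=> hs; rewrite /form -csum_conj//; congr cint; apply/funext => x.
exact: slot_prod_conj.
Qed.

Lemma inLH_conj f : LH f -> LH (fun y => conjc (f y)).
Proof.
move=> /(inLHE naE nbE) foo; apply/(inLHE naE nbE).
congr (iint _ _ < _)%E: foo; apply/funext => x; congr (_%:E).
by apply: eq_bigr => j _; rewrite normc_conjc.
Qed.

(** * The tensor power trick *)

Variables (p : nat -> nat * nat) (p_bij : bijective p).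
Local Notation tens := (tensor (fun t => (p t).1) (fun t => (p t).2)).

Lemma form_tensor h h' : csummable (slot_prod h) -> csummable (slot_prod h') ->
  form (fun j => tens (h j) (h' j)) = form h * form h'.
Proof.
move=> hs hs'; rewrite /form -(csum_pair p_bij)//; congr cint; apply/funext => x.
exact: slot_prod_tensor.
Qed.

Lemma inLH_tensor f g : LH f -> LH g -> LH (tens f g).
Proof.
move=> /(inLHE naE nbE) foo /(inLHE naE nbE) goo; apply/(inLHE naE nbE).
have pos (e : k.-tuple nat -> C) x :
    (0 <= (\prod_(j : slot na nb) normc (e (hproj (tag j) x)))%:E)%E.
  by rewrite lee_fin prodr_ge0// => j _; exact: normc_ge0.
have := ge0_iint_pair p_bij (pos f) (pos g).
under eq_fun => x.
  rewrite -EFinM -big_split /=.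
  under eq_bigr do rewrite !hproj_map -ComplexField.Normc.normcM.
  over.
move=> ->; rewrite ltey_eq fin_numM// ge0_fin_numE//; exact: iint_ge0.
Qed.

Lemma choice_tensor s f1 f2 g1 g2 :
  choice s (tens f1 f2) (tens g1 g2) =
  fun j => tens (choice s f1 g1 j) (choice s f2 g2 j).
Proof. by apply/funext => j; rewrite /slot_choice; case: (s j). Qed.

Lemma norm_tensor_le1 f g : LH f -> LH g -> norm f <= 1 -> norm g <= 1 ->
  norm (tens f g) <= 1.
Proof.
move=> fL gL f1 g1.
have := form_norm (inLH_tensor fL gL).
(* The diagonal form of [e] is a choice between [e] and itself, whence its summability. *)
have cs e (eL : LH e) := csummable_choice [ffun=> true] eL eL.
have csE e : choice [ffun=> true] e e = fun=> e.
  by apply/funext => j; rewrite /slot_choice if_same.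
have:= form_tensor (cs f fL) (cs g gL); rewrite !csE => ->.
rewrite !form_norm// -rmorphM => /(congr1 (@complex.Re R))/= E.
rewrite -(@expr_le1 _ n)// ?norm_ge0// -E.
by rewrite mulr_ile1 ?exprn_ge0 ?exprn_ile1 ?norm_ge0.
Qed.

Lemma form_le_card s f g : LH f -> LH g -> norm f <= 1 -> norm g <= 1 ->
  (forall s', 0 <= form (choice s' f g)) -> form (choice s f g) <= (2 ^+ n)%:C%C.
Proof.
move=> fL gL f1 g1 pos.
have sgL : LH (fun y => f y + g y) by case: sn => _ + _ _ _; apply.
apply: (@le_trans _ _ (form (fun=> fun y => f y + g y))).
  by rewrite form_expand// (bigD1 s)//= lerDl sumr_ge0.
rewrite form_norm// lecR lerXn2r ?nnegrE ?norm_ge0//.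
case: sn => _ _ _ _ /(_ f g fL gL) /le_trans; apply.
by rewrite -[2]/(1 + 1) lerD.
Qed.

Lemma form_le1 s f g : LH f -> LH g -> norm f <= 1 -> norm g <= 1 ->
  (forall s', 0 <= form (choice s' f g)) -> form (choice s f g) <= 1.
Proof.
move=> fL gL f1 g1 pos.
(* In the order of [R[i]] a nonnegative number is real, so the bound can be sought for its real
   part. *)
have E : form (choice s f g) = (complex.Re (form (choice s f g)))%:C%C.
  by case: (form _) (pos s) => a b; rewrite lecE/= => /andP[/eqP->].
rewrite E lecR; apply: (@le1_of_expr_bounded _ _ (2 ^+ n)) => m.
rewrite -lecR rmorphXn/= -E {E}.
(* The induction varies the functions: the tensor squares stay in the unit ball, and their forms are
   the squares of the old ones, hence again nonnegative. *)
elim: m f g fL gL f1 g1 pos => [|m IH] f g fL gL f1 g1 pos.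
  by rewrite expn0 expr1; exact: form_le_card.
have sq s' : form (choice s' (tens f f) (tens g g)) = form (choice s' f g) ^+ 2.
  by rewrite choice_tensor form_tensor//; exact: csummable_choice.
rewrite expnS exprM -sq; apply: IH; [exact: inLH_tensor..|
  exact: norm_tensor_le1|exact: norm_tensor_le1|].
by move=> s'; rewrite sq exprn_ge0.
Qed.

Lemma norm_conj f : LH f -> norm (fun y => conjc (f y)) = norm f.
Proof.
move=> fL; rewrite /hnorm !cint_fH form_conj.
  by case: (form _).
have := csummable_choice [ffun=> true] fL fL.
congr (csummable (slot_prod _)).
by apply/funext => j; rewrite /slot_choice if_same.
Qed.

Lemma normc_form_le1 s f g : LH f -> LH g -> norm f <= 1 -> norm g <= 1 ->
  normc (form (choice s f g)) <= 1.
Proof.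
move=> fL gL f1 g1.
pose cj (e : k.-tuple nat -> C) := fun y => conjc (e y).
(* Conjugating all functions conjugates the form, so the tensored form is [z] times its
   conjugate. *)
have sq s' : form (choice s' (tens f (cj f)) (tens g (cj g))) =
    `|form (choice s' f g)| ^+ 2.
  rewrite choice_tensor form_tensor; last 2 first.
  - exact: csummable_choice.
  - by apply: csummable_choice; exact: inLH_conj.
  rewrite sqr_normc; congr (_ * _); rewrite -form_conj; last exact: csummable_choice.
  by congr form; apply/funext => j; rewrite /slot_choice; case: (s' j).
have := @form_le1 s (tens f (cj f)) (tens g (cj g)).
rewrite sq expr_le1// => le1.
suff: `|form (choice s f g)| <= 1 by rewrite -[X in _ <= X](rmorph1 (real_complex R)) lecR.
apply: le1.
- by apply: inLH_tensor => //; exact: inLH_conj.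
- by apply: inLH_tensor => //; exact: inLH_conj.
- by apply: norm_tensor_le1; rewrite ?norm_conj//; exact: inLH_conj.
- by apply: norm_tensor_le1; rewrite ?norm_conj//; exact: inLH_conj.
by move=> s'; rewrite sq exprn_ge0.
Qed.

(** By homogeneity it suffices to treat the unit ball, where [normc_form_le1] applies. The shift by
    [e] permits the rescaling even when a semi-norm is zero. *)
Lemma form_hoelder s f g : LH f -> LH g ->
  normc (form (choice s f g)) <= \prod_j (if s j then norm g else norm f).
Proof.
move=> fL gL; apply: le_prod_of_addgt0.
  by move=> j; case: (s j); exact: norm_ge0.
move=> e e0.
pose c u : R := (norm u + e)^-1.
have c0 u : 0 < norm u + e by rewrite ltr_wpDl ?norm_ge0.
have scale u : LH u -> LH (fun y => (c u)%:C%C * u y) /\ norm (fun y => (c u)%:C%C * u y) <= 1.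
  move=> uL; case: sn => _ _ /(_ (c u)%:C%C u uL) cuL /(_ (c u)%:C%C u uL) -> _.
  split=> //; rewrite normc_real ger0_norm ?invr_ge0 ?(ltW (c0 _))//.
  by rewrite mulrC ler_pdivrMr// mul1r lerDl ltW.
have [fL' f1] := scale f fL; have [gL' g1] := scale g gL.
have := normc_form_le1 s fL' gL' f1 g1.
have -> : choice s (fun y => (c f)%:C%C * f y) (fun y => (c g)%:C%C * g y) =
    fun j y => (if s j then c g else c f)%:C%C * choice s f g j y.
  by apply/funext => j; apply/funext => y; rewrite /slot_choice; case: (s j).
rewrite formZ; last exact: csummable_choice.
rewrite ComplexField.Normc.normcM normc_real.
have -> : \prod_j (if s j then c g else c f) =
    (\prod_j ((if s j then norm g else norm f) + e))^-1.
  by rewrite -prodfV; apply: eq_bigr => j _; rewrite /c; case: (s j).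
have P0 : 0 < \prod_j ((if s j then norm g else norm f) + e).
  by apply: prodr_gt0 => j _; case: (s j).
by rewrite ger0_norm ?invr_ge0 ?(ltW P0)// mulrC ler_pdivrMr// mul1r.
Qed.

(** Both sides are expanded over the same assignments with the same weights [1 + sg s], then
    compared term by term. The last difference is taken with its sign, which for odd [n] gives the
    stronger bound. *)
Lemma norm_add_sub_le f g : LH f -> LH g ->
  norm (fun y => f y + g y) ^+ n + norm (fun y => f y - g y) ^+ n <=
  (norm f + norm g) ^+ n + (norm f - norm g) ^+ n.
Proof.
move=> fL gL; case: (sn) => _ snD snZ _ _.
pose ng y := -1 * g y.
have ngL : LH ng by exact: snZ.
have -> : (fun y => f y - g y) = fun y => f y + ng y.
  by apply/funext => y; rewrite /ng mulN1r.
(* The parity sign of the number of slots filled by [g]: the weight [1 + sg s] is 2 if that number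
   is even and 0 if it is odd. *)
pose sg (s : {ffun slot na nb -> bool}) : R := \prod_j (if s j then -1 else 1).
have sgE s : form (choice s f ng) = (sg s)%:C%C * form (choice s f g).
  rewrite -formZ; last exact: csummable_choice.
  congr form; apply/funext => j; apply/funext => y; rewrite /slot_choice /ng.
  by case: (s j); rewrite ?rmorphN rmorph1 ?mul1r.
have sg_norm s : `|sg s| = 1.
  by rewrite normr_prod big1// => j _; case: (s j); rewrite ?normrN normr1.
have expand (a b : R) : (a + b) ^+ n =
    \sum_(s : {ffun slot na nb -> bool}) \prod_j (if s j then b else a).
  by rewrite -prodr_const prod_choiceD.
have {expand} -> : (norm f + norm g) ^+ n + (norm f - norm g) ^+ n =
    \sum_s (1 + sg s) * \prod_j (if s j then norm g else norm f).
  rewrite !expand -big_split; apply: eq_bigr => s _ /=.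
  rewrite mulrDl mul1r; congr (_ + _); rewrite -big_split; apply: eq_bigr => j _ /=.
  by case: (s j); rewrite ?mul1r ?mulN1r.
have normE u : LH u -> norm u ^+ n = complex.Re (form (fun=> u)).
  by move=> /form_norm ->.
rewrite !normE; [|exact: snD..].
rewrite -raddfD !form_expand// -big_split raddf_sum; apply: ler_sum => s _.
rewrite sgE [leLHS](_ : _ = (1 + sg s) * complex.Re (form (choice s f g))); last first.
  by case: (form _) => u v; rewrite mulrDl mul1r /= mul0r subr0.
rewrite ler_wpM2l//.
  (* The weight is nonnegative since [|sg s| = 1], so the Hoelder bound may be multiplied by it. *)
  by rewrite addrC -lerBlDr sub0r -(sg_norm s) lerNnormlW.
apply: le_trans (form_hoelder s fL gL); apply: le_trans (ler_norm _) _.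
by case: (normc_ge_ReIm (form (choice s f g))).
Qed.

End Hoelder.

(* The library declares [counting] sigma-finite but not s-finite, and so not a
   [{sigma_finite_measure _ -> _}]. *)
HB.instance Definition _ (R : realType) :=
  @Measure_isSigmaFinite.Build default_measure_display nat R (@counting nat R)
    (sigma_finite_counting R).

Theorem theorem3p10 (R : realType) (k : nat) (H : hpair R k) :
  non_factorizable H -> semi_norming H ->
  (typeII H \/ exists s : R, typeI H s /\ exists m : int, s = (2 * m)%:~R) ->
  forall f g : k.-tuple nat -> R[i], in_lH H f -> in_lH H g ->
  lHnorm H (fun x => f x + g x) `^ hsize H + lHnorm H (fun x => f x - g x) `^ hsize H
  <= (lHnorm H f + lHnorm H g) `^ hsize H + `|lHnorm H f - lHnorm H g| `^ hsize H.
Proof.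
move=> _ [_ [_ sn]] Htype f g fL gL.
have {}sn : seminorm_on H (cnt R) := sn _ nat (cnt R).
have [na [nb [naE nbE]]] : exists na nb : hedge H -> nat,
    (forall w, halpha w = (na w)%:R) /\ (forall w, hbeta w = (nb w)%:R).
  (* Both types force natural exponents: [(0, 0)] off the support, [(0, 1)] or [(1, 0)] for Type II,
     [(m, m)] for Type I with [s = 2 * m]. *)
  suff wE (w : hedge H) : exists ab : nat * nat, halpha w = ab.1%:R /\ hbeta w = ab.2%:R.
    have [ab abE] := boolp.choice wE.
    by exists (fun w => (ab w).1), (fun w => (ab w).2); split=> w; case: (abE w).
  have [ws|ws] := pselect (hsupp w); last first.
    by exists (0, 0)%N; split; apply/eqP/contraT => w0; case: ws; [left|right].
  case: Htype => [/(_ _ ws)[[-> ->]|[-> ->]]|]; [by exists (0, 1)%N|by exists (1, 0)%N|].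
  move=> [s [[s1 /(_ _ ws)[-> ->]] [m sE]]]; exists (`|m|, `|m|)%N.
  (* The condition [1 <= s] rules out a negative [m], so [s / 2] is the natural number [|m|]. *)
  have m0 : 0 <= m.
    by move: (le_trans ler01 s1); rewrite sE ler0z pmulr_rge0.
  by rewrite natr_absz ger0_norm// sE intrM mulrAC divff ?mul1r// intr_eq0.
pose n := #|slot na nb|.
have hE : hsize H = n%:R by exact: hsizeE.
(* Without slots the exponent is 0, every power is 1, and both sides equal 2. *)
have [n0|n0] := posnP n.
  by rewrite hE n0 !powRr0.
have [p p_bij] := bijective_nat_pair.
rewrite hE !powR_mulrn ?addr_ge0 ?powR_ge0//.
apply: le_trans (norm_add_sub_le naE nbE sn n0 p_bij fL gL) _.
by rewrite lerD2l -normrX ler_norm.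
Qed.
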